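(* If $\mathcal{F}$ is a factorization of $\Delta^2$ in $B_3$ into three positive half-twists and one cube of a positive half-twist (in any order), then $\mathcal{F}$ is Hurwitz equivalent to the factorization $(\sigma_1^3,\sigma_1^{-1}\sigma_2\sigma_1,\sigma_1,\sigma_2)$ of $\Delta^2$.
   Context: $B_3=\langle\sigma_1,\sigma_2:\sigma_1\sigma_2\sigma_1=\sigma_2\sigma_1\sigma_2\rangle$ and $\Delta=\sigma_1\sigma_2\sigma_1$; $\Delta^2$ is central in $B_3$. A positive half-twist is a conjugate of $\sigma_1$ in $B_3$. A factorization of $g$ in a group $G$ is a tuple $(g_1,\dots,g_m)$ of elements of $G$ with $g=g_1\cdots g_m$. A Hurwitz move replaces adjacent factors $(g_j,g_{j+1})$ by $(g_jg_{j+1}g_j^{-1},g_j)$ or by $(g_{j+1},g_{j+1}^{-1}g_jg_{j+1})$. Two factorizations of a central element are Hurwitz equivalent if they are related by a finite sequence of Hurwitz moves and global conjugations $(g_1,\dots,g_m)\mapsto(hg_1h^{-1},\dots,hg_mh^{-1})$, $h\in G$. *)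

(* Defs.v *)
From HB Require Import structures.
From mathcomp Require Import all_boot.
From mathcomp Require Import boolp.
From Stdlib Require Import Relations.

Set Implicit Arguments.
Unset Strict Implicit.
Unset Printing Implicit Defensive.

Local Open Scope group_scope.
Local Open Scope quotient_scope.

(* Words in sigma_1^{+-1}, sigma_2^{+-1}. A letter is (i, e): i = false stands
   for sigma_1 and i = true for sigma_2, and e = true marks an inverse.        *)
Definition braid_word := seq (bool * bool).

(* The least congruence on words containing free cancellation and the braid
   relation; two words are related iff they represent the same element of
   B_3 = < sigma_1, sigma_2 : sigma_1 sigma_2 sigma_1 = sigma_2 sigma_1 sigma_2 >. *)
Inductive braid_eq : braid_word -> braid_word -> Prop :=
| braid_eq_refl u : braid_eq u u
| braid_eq_sym u v : braid_eq u v -> braid_eq v u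
| braid_eq_trans u v w : braid_eq u v -> braid_eq v w -> braid_eq u w
| braid_eq_cat u u' v v' :
    braid_eq u u' -> braid_eq v v' -> braid_eq (u ++ v) (u' ++ v')
| braid_eq_cancel i e : braid_eq [:: (i, e); (i, ~~ e)] [::]
| braid_eq_braid :
    braid_eq [:: (false, false); (true, false); (false, false)]
             [:: (true, false); (false, false); (true, false)].

Definition braid_eqb (u v : braid_word) : bool := `[< braid_eq u v >].

Lemma braid_eqb_equiv : equiv_class_of braid_eqb.
Proof.
split=> [u | u v | v u w /asboolP uv /asboolP vw].
- exact/asboolP/braid_eq_refl.
- by apply/asboolP/asboolP; apply: braid_eq_sym.
- exact/asboolP/(braid_eq_trans uv).
Qed.

Canonical braid_equiv := EquivRelPack braid_eqb_equiv.

Definition B3 := {eq_quot braid_equiv}.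

HB.instance Definition _ := EqQuotient.on B3.
HB.instance Definition _ := Choice.on B3.

Lemma B3_eqP (u v : braid_word) :
  reflect (braid_eq u v) (\pi_B3 u == \pi_B3 v).
Proof. by rewrite piE; apply: asboolP. Qed.

Lemma braid_eq_repr (u : braid_word) : braid_eq (repr (\pi_B3 u)) u.
Proof. by apply/B3_eqP; rewrite reprK. Qed.

Definition braid_word_inv (u : braid_word) : braid_word :=
  rev [seq (l.1, ~~ l.2) | l <- u].

Lemma braid_word_invK : involutive braid_word_inv.
Proof.
move=> u; rewrite /braid_word_inv map_rev revK -map_comp.
by rewrite -[RHS]map_id; apply: eq_map => -[i e] /=; rewrite negbK.
Qed.

Lemma braid_word_invP u : braid_eq (u ++ braid_word_inv u) [::].
Proof.
elim: u => [|[i e] u IH]; first exact: braid_eq_refl.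
have -> : ((i, e) :: u) ++ braid_word_inv ((i, e) :: u)
          = [:: (i, e)] ++ (u ++ braid_word_inv u) ++ [:: (i, ~~ e)].
  by rewrite /braid_word_inv /= rev_cons -cats1 catA.
apply: (braid_eq_trans _ (braid_eq_cancel i e)).
apply: (@braid_eq_cat [:: (i, e)] [:: (i, e)] _ ([::] ++ [:: (i, ~~ e)])).
  exact: braid_eq_refl.
by apply: braid_eq_cat => //; apply: braid_eq_refl.
Qed.

Definition B3_one : B3 := \pi_B3 [::].
Definition B3_mul (x y : B3) : B3 := \pi_B3 (repr x ++ repr y).
Definition B3_inv (x : B3) : B3 := \pi_B3 (braid_word_inv (repr x)).

Lemma B3_mulE u v : B3_mul (\pi_B3 u) (\pi_B3 v) = \pi_B3 (u ++ v).
Proof.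
rewrite /B3_mul; apply/eqP/B3_eqP.
by apply: braid_eq_cat; apply: braid_eq_repr.
Qed.

Lemma B3_mulA : associative B3_mul.
Proof.
elim/quotW=> u; elim/quotW=> v; elim/quotW=> w.
by rewrite (B3_mulE u v) (B3_mulE v w) (B3_mulE u) (B3_mulE (u ++ v)) catA.
Qed.

Lemma B3_mul1x : left_id B3_one B3_mul.
Proof. by elim/quotW=> u; rewrite B3_mulE. Qed.

Lemma B3_mulx1 : right_id B3_one B3_mul.
Proof. by elim/quotW=> u; rewrite B3_mulE cats0. Qed.

Lemma B3_mulxV : right_inverse B3_one B3_inv B3_mul.
Proof.
move=> x; rewrite -{1}[x]reprK B3_mulE; apply/eqP/B3_eqP.
exact: braid_word_invP.
Qed.

Lemma B3_mulVx : left_inverse B3_one B3_inv B3_mul.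
Proof.
move=> x; rewrite -{2}[x]reprK B3_mulE; apply/eqP/B3_eqP.
by have := braid_word_invP (braid_word_inv (repr x)); rewrite braid_word_invK.
Qed.

HB.instance Definition _ :=
  isGroup.Build B3 B3_mulA B3_mul1x B3_mulx1 B3_mulVx B3_mulxV.

Definition sigma1 : B3 := \pi_B3 [:: (false, false)].
Definition sigma2 : B3 := \pi_B3 [:: (true, false)].
Definition Delta : B3 := sigma1 * sigma2 * sigma1.

Definition positive_half_twist (g : B3) : Prop := exists h : B3, g = sigma1 ^ h.

Definition cube_of_half_twist (g : B3) : Prop :=
  exists2 x : B3, positive_half_twist x & g = x ^+ 3.

Section Factorizations.
Variable G : groupType.

Definition factorization (g : G) (F : seq G) : Prop := \prod_(x <- F) x = g.

Inductive hurwitz_step : seq G -> seq G -> Prop :=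
| hurwitz_move_l s g h t :
    hurwitz_step (s ++ [:: g, h & t]) (s ++ [:: g * h * g^-1, g & t])
| hurwitz_move_r s g h t :
    hurwitz_step (s ++ [:: g, h & t]) (s ++ [:: h, h^-1 * g * h & t])
| hurwitz_global_conj h s :
    hurwitz_step s [seq h * g * h^-1 | g <- s].

(* Every step can be undone by another step, so this closure is symmetric. *)
Definition hurwitz_equivalent : seq G -> seq G -> Prop :=
  clos_refl_trans (seq G) hurwitz_step.

End Factorizations.

(* Main.v *)
Require Import Defs.
From mathcomp Require Import all_boot.
From Stdlib Require Import ZArith Lia Relations.

Set Implicit Arguments.
Unset Strict Implicit.
Unset Printing Implicit Defensive.

Local Open Scope group_scope.
Local Open Scope quotient_scope.

(** The theorem is proved by transporting the problem to the plane lattice and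
    running a descent there.

    Let B_3 act on Z^2 through SL_2(Z), sigma_1 and sigma_2 acting by elementary
    shears.  A positive half-twist h sigma_1 h^-1 acts by the transvection
    w |-> w + det(v, w) v along the vector v = h e_1, and conjugating the
    half-twist by k moves v to k v.  The vector, up to sign, determines the
    half-twist ([twist_vec_inj]): this is the statement that a braid fixing the
    line of e_1 commutes with sigma_1 ([sigma1_centralizer]), and follows from a
    normal form for B_3 modulo its centre.

    Hurwitz moves bring the cube to the front and a global conjugation turns it
    into sigma_1^3, so that the factorization is (sigma_1^3, b, c, d).  Let u, v, w
    be the vectors of b, c, d and call the absolute value of the second coordinate
    of a vector its height; the height of u is |det(u, e_1)|.  Since Delta^2 acts by
    -1 and sigma_1 fixes e_1, the product b c d sends e_1 to -e_1, which gives
    ([height_relations])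
      u_2^2 = v_2^2 + w_2^2 + det(v, w) v_2 w_2
    and a similar identity for w_2^2.  They say that the Hurwitz move replacing
    w by w' = w + det(v, w) v satisfies w_2 w'_2 = u_2^2 - v_2^2, and likewise
    for the other two vectors.  Hence, when all heights are nonzero, a move at
    the largest one strictly decreases it, and a descent
    ([hurwitz_descent]) reaches a factorization in which one of the vectors is
    horizontal, that is, one of b, c, d is sigma_1.

    In that case Hurwitz moves make the factorization (sigma_1^3, sigma_1, c, d),
    and c d sends e_1 to -e_1; as the vectors are primitive, this forces that of c
    to have height 1 ([height_one_of_sigma1]).  Up to sign, all vectors of height 1
    are equivalent under powers of sigma_1, which fix the first two factors, so c
    can be prescribed by a global conjugation; d is then determined by the
    product. *)

(** * The action of B_3 on the plane lattice *)

Definition letter_act (l : bool * bool) (v : Z * Z) : Z * Z :=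
  match l with
  | (false, false) => (v.1 + v.2, v.2)%Z
  | (false, true) => (v.1 - v.2, v.2)%Z
  | (true, false) => (v.1, v.2 - v.1)%Z
  | (true, true) => (v.1, v.2 + v.1)%Z
  end.

Definition word_act (u : braid_word) (v : Z * Z) : Z * Z := foldr letter_act v u.

Lemma word_act_cat u w v : word_act (u ++ w) v = word_act u (word_act w v).
Proof. by rewrite /word_act foldr_cat. Qed.

Lemma word_act_braid u w : braid_eq u w -> word_act u =1 word_act w.
Proof.
elim=> {u w}.
- by [].
- by move=> u w _ IH v; rewrite IH.
- by move=> u w t _ IH1 _ IH2 v; rewrite IH1.
- by move=> u u' w w' _ IH1 _ IH2 v; rewrite !word_act_cat IH2 IH1.
- by case=> -[] [p q] /=; congr pair; ring.
- by case=> p q /=; congr pair; ring.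
Qed.

Definition rho (g : B3) : Z * Z -> Z * Z := word_act (repr g).

Lemma rho_pi u v : rho (\pi_B3 u) v = word_act u v.
Proof. exact/word_act_braid/braid_eq_repr. Qed.

Lemma rhoM (g h : B3) v : rho (g * h) v = rho g (rho h v).
Proof. by rewrite rho_pi word_act_cat. Qed.

Lemma rho1 v : rho 1 v = v.
Proof. exact: rho_pi. Qed.

Lemma rhoK g : cancel (rho g) (rho g^-1).
Proof. by move=> v; rewrite -rhoM mulVg rho1. Qed.

Lemma rho_sigma1 v : rho sigma1 v = (v.1 + v.2, v.2)%Z.
Proof. exact: rho_pi. Qed.

Lemma rho_sigma2 v : rho sigma2 v = (v.1, v.2 - v.1)%Z.
Proof. exact: rho_pi. Qed.

Lemma rho_sigma1V v : rho sigma1^-1 v = (v.1 - v.2, v.2)%Z.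
Proof.
apply: (can_inj (rhoK sigma1)); rewrite -rhoM mulgV rho1 rho_sigma1.
by case: v => p q /=; congr pair; ring.
Qed.

Definition det (v w : Z * Z) : Z := (v.1 * w.2 - v.2 * w.1)%Z.

Lemma rho_det g v w : det (rho g v) (rho g w) = det v w.
Proof.
rewrite /rho; elim: (repr g) => //= l u <-.
by rewrite /det; case: l => -[] [] /=; ring.
Qed.

(** Translation of [w] by a multiple of [v]; with coefficient [det v w] this is the
    transvection along [v]. *)
Definition shear (v : Z * Z) (n : Z) (w : Z * Z) : Z * Z :=
  (w.1 + n * v.1, w.2 + n * v.2)%Z.

Lemma rho_shear g v n w : rho g (shear v n w) = shear (rho g v) n (rho g w).
Proof.
rewrite /rho; elim: (repr g) => //= l u ->.
by rewrite /shear; case: l => -[] [] /=; congr pair; ring.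
Qed.

(** * The centre and a normal form *)

Lemma B3_ind (P : B3 -> Prop) :
  P 1 -> (forall g, P g -> P (sigma1 * g)) -> (forall g, P g -> P (sigma1^-1 * g)) ->
  (forall g, P g -> P (sigma2 * g)) -> (forall g, P g -> P (sigma2^-1 * g)) ->
  forall g, P g.
Proof.
move=> P1 Ps1 Ps1V Ps2 Ps2V; elim/quotW; elim=> [//|l u IH].
have letterV i : \pi_B3 [:: (i, true)] = (\pi_B3 [:: (i, false)])^-1.
  apply: (mulgI (\pi_B3 [:: (i, false)])); rewrite mulgV.
  apply: etrans (B3_mulE _ _) _; exact/eqP/B3_eqP/braid_eq_cancel.
have -> : \pi_B3 (l :: u) = \pi_B3 [:: l] * \pi_B3 u.
  by symmetry; apply: B3_mulE.
case: l => -[] [].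
- by rewrite letterV; apply: Ps2V.
- exact: Ps2.
- by rewrite letterV; apply: Ps1V.
- exact: Ps1.
Qed.

Lemma sigma_braid : sigma1 * sigma2 * sigma1 = sigma2 * sigma1 * sigma2.
Proof.
have E (a b c : bool * bool) :
    \pi_B3 [:: a] * \pi_B3 [:: b] * \pi_B3 [:: c] = \pi_B3 [:: a; b; c].
  by rewrite [X in X * _](B3_mulE [:: a]) [LHS](B3_mulE [:: a; b]).
by rewrite !E; apply/eqP/B3_eqP/braid_eq_braid.
Qed.

Lemma Delta_sigma2 : Delta * sigma2 = sigma1 * sigma2 * (sigma1 * sigma2).
Proof. by rewrite /Delta !mulgA. Qed.

Lemma DeltaV_sigma1 : Delta * sigma1^-1 = sigma1 * sigma2.
Proof. by rewrite /Delta mulgK. Qed.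

Lemma Delta_sq : Delta * Delta = sigma1 * sigma2 * (sigma1 * sigma2) * (sigma1 * sigma2).
Proof. by rewrite -Delta_sigma2 {2}/Delta sigma_braid !mulgA. Qed.

Lemma Delta_sigma12 : Delta * (sigma1 * sigma2) = Delta * Delta * sigma1^-1.
Proof. by rewrite -DeltaV_sigma1 mulgA. Qed.

Lemma Delta_conj1 : Delta * sigma1 = sigma2 * Delta.
Proof. by rewrite /Delta {1}sigma_braid -!mulgA. Qed.

Lemma Delta_conj2 : sigma1 * Delta = Delta * sigma2.
Proof. by rewrite Delta_sigma2 /Delta sigma_braid -!mulgA. Qed.

(** B_3 is generated by x = sigma_1 sigma_2 and Delta, and Delta^2 = x^3. *)
Lemma Delta_sq_central g : commute (Delta * Delta) g.
Proof.
have Cx : commute (Delta * Delta) (sigma1 * sigma2).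
  by rewrite /commute Delta_sq !mulgA.
have CD : commute (Delta * Delta) Delta by rewrite /commute -mulgA.
have C1 : commute (Delta * Delta) sigma1.
  by rewrite -[sigma1](mulKg (sigma1 * sigma2)); apply: commuteM CD; exact: commuteV.
have C2 : commute (Delta * Delta) sigma2.
  by rewrite -[sigma2](mulKg sigma1); apply: commuteM Cx; exact: commuteV.
elim/B3_ind: g => [|g|g|g|g]; first exact: commute1; apply: commuteM => //;
  exact: commuteV.
Qed.

(** The monoid generated by sigma_1^-1 and sigma_2: both generators preserve the
    cone of vectors (p, -q) with p, q >= 0, on which the coordinates p and q can
    only grow. *)
Inductive cone_monoid : B3 -> Prop :=
| cone1 : cone_monoid 1
| coneMl m : cone_monoid m -> cone_monoid (sigma1^-1 * m)
| coneMr m : cone_monoid m -> cone_monoid (sigma2 * m).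

Lemma cone_monoid_act m : cone_monoid m -> forall p q, (0 <= p)%Z -> (0 <= q)%Z ->
  exists p' q', rho m (p, - q)%Z = (p', - q')%Z /\ (p <= p' /\ q <= q')%Z.
Proof.
elim=> {m} [|m _ IH|m _ IH] p q p0 q0.
- by exists p, q; rewrite rho1; split=> //; lia.
- have [p' [q' [E ?]]] := IH p q p0 q0.
  exists (p' + q')%Z, q'; rewrite rhoM E rho_sigma1V /=.
  by split; [congr pair; ring | lia].
- have [p' [q' [E ?]]] := IH p q p0 q0.
  exists p', (p' + q')%Z; rewrite rhoM E rho_sigma2 /=.
  by split; [congr pair; ring | lia].
Qed.

(** A factor sigma_2 would give e_1 a nonzero second coordinate, which no later
    factor can cancel; so [m] is a power of sigma_1. *)
Lemma cone_monoid_fix_sigma1 m :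
  cone_monoid m -> (rho m (1, 0)%Z).2 = 0%Z -> commute m sigma1.
Proof.
elim=> {m} [|m _ IH|m mC _].
- by move=> _; apply/commute_sym/commute1.
- rewrite rhoM rho_sigma1V /= => /IH C; apply/commute_sym/commuteM.
    exact/commuteV.
  exact/commute_sym.
- have [p [q [E ?]]] := cone_monoid_act mC (p := 1) (q := 0) ltac:(lia) ltac:(lia).
  by rewrite rhoM rho_sigma2 E /=; lia.
Qed.

Lemma cone_monoid_fix_sigma2 m :
  cone_monoid m -> (rho m (0, -1)%Z).1 = 0%Z -> commute m sigma2.
Proof.
elim=> {m} [|m mC _|m _ IH].
- by move=> _; apply/commute_sym/commute1.
- have [p [q [E ?]]] := cone_monoid_act mC (p := 0) (q := 1) ltac:(lia) ltac:(lia).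
  by rewrite rhoM rho_sigma1V E /=; lia.
- by rewrite rhoM rho_sigma2 /= => /IH C; apply/commute_sym/commuteM.
Qed.

(** Elements that can be neglected when asking whether a line is preserved, or
    whether a braid commutes with sigma_1: the powers of Delta^2. *)
Definition center_sign (z : B3) : Prop :=
  (forall g, commute z g) /\
  exists2 s : Z, (s * s = 1)%Z & forall v, rho z v = (s * v.1, s * v.2)%Z.

Lemma center_sign1 : center_sign 1.
Proof.
split=> [g|]; first exact/commute_sym/commute1.
by exists 1%Z => // -[p q]; rewrite rho1 !Z.mul_1_l.
Qed.

Lemma center_signM y z : center_sign y -> center_sign z -> center_sign (y * z).
Proof.
move=> [Cy [s s2 Ey]] [Cz [t t2 Ez]]; split=> [g|].
  by apply/commute_sym/commuteM/commute_sym/Cz; apply/commute_sym/Cy.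
exists (s * t)%Z => [|v]; first by nia.
by rewrite rhoM Ez Ey /=; congr pair; ring.
Qed.

Lemma rho_Delta v : rho Delta v = (v.2, - v.1)%Z.
Proof.
by rewrite /Delta !rhoM !(rho_sigma1, rho_sigma2) /=; congr pair; ring.
Qed.

Lemma center_sign_Delta2 : center_sign (Delta * Delta).
Proof.
split; first exact: Delta_sq_central.
by exists (-1)%Z => // v; rewrite rhoM !rho_Delta /=; congr pair; ring.
Qed.

Lemma center_sign_Delta2V : center_sign (Delta * Delta)^-1.
Proof.
split=> [g|]; first exact/commute_sym/commuteV/commute_sym/Delta_sq_central.
exists (-1)%Z => // v; apply: (can_inj (rhoK (Delta * Delta))).
rewrite -rhoM mulgV rho1 rhoM !rho_Delta.
by case: v => p q; congr pair; cbn [fst snd]; ring.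
Qed.

(** Modulo its centre, B_3 is the free product of the groups of orders 3 and 2
    generated by x = sigma_1 sigma_2 and Delta.  Since sigma_1^-1 and sigma_2 are
    Delta^-1 x and Delta^-1 x^2, an alternating word in x and Delta is, up to the
    centre, a word in sigma_1^-1 and sigma_2 preceded by a power of x and followed by
    a power of Delta. *)
Definition normal_form (g : B3) : Prop :=
  exists z r m t, [/\ center_sign z,
    r \in [:: 1; sigma1 * sigma2; sigma1 * sigma2 * (sigma1 * sigma2)],
    cone_monoid m, t \in [:: 1; Delta] & g = z * r * m * t].

Lemma normal_form_center z g : center_sign z -> normal_form g -> normal_form (z * g).
Proof.
move=> zC [y [r [m [t [yC rP mC tP ->]]]]]; exists (z * y), r, m, t.
by split=> //; [exact: center_signM | rewrite !mulgA].
Qed.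

Lemma normal_form_rot g : normal_form g -> normal_form (sigma1 * sigma2 * g).
Proof.
move=> [z [r [m [t [zC rP mC tP ->]]]]]; have [zZ _] := zC.
have -> : sigma1 * sigma2 * (z * r * m * t) = z * (sigma1 * sigma2 * r * m * t).
  by rewrite -!(mulgA z) (mulgA _ z) -(zZ (sigma1 * sigma2)) !mulgA.
apply: normal_form_center => //.
move: rP; rewrite !inE => /or3P[] /eqP ->.
- exists 1, (sigma1 * sigma2), m, t; split=> //; first exact: center_sign1.
    by rewrite !inE eqxx orbT.
  by rewrite mulg1 mul1g.
- exists 1, (sigma1 * sigma2 * (sigma1 * sigma2)), m, t.
  split=> //; first exact: center_sign1.
    by rewrite !inE eqxx !orbT.
  by rewrite mul1g.
- exists (Delta * Delta), 1, m, t; split=> //.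
  + exact: center_sign_Delta2.
  + by rewrite inE eqxx.
  + by rewrite mulg1 Delta_sq !mulgA.
Qed.

Lemma normal_form_Delta g : normal_form g -> normal_form (Delta * g).
Proof.
move=> [z [r [m [t [zC rP mC tP ->]]]]]; have [zZ _] := zC.
have -> : Delta * (z * r * m * t) = z * (Delta * (r * m * t)).
  by rewrite -!(mulgA z) (mulgA _ z) -(zZ Delta) -(mulgA z).
apply: normal_form_center => //.
move: rP; rewrite !inE => /or3P[] /eqP ->.
- rewrite mul1g; case: mC => [|m' mC|m' mC].
  + rewrite mul1g; move: tP; rewrite !inE => /orP[] /eqP ->.
      exists 1, 1, 1, Delta.
      split; [exact: center_sign1 | by rewrite inE eqxx | exact: cone1 | |].
        by rewrite !inE eqxx orbT.
      by rewrite !mul1g mulg1.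
    exists (Delta * Delta), 1, 1, 1.
    split; [exact: center_sign_Delta2 | by rewrite inE eqxx | exact: cone1 | |].
      by rewrite !inE eqxx.
    by rewrite !mulg1.
  + exists 1, (sigma1 * sigma2), m', t; split=> //; first exact: center_sign1.
      by rewrite !inE eqxx orbT.
    by rewrite mul1g -DeltaV_sigma1 -!mulgA.
  + exists 1, (sigma1 * sigma2 * (sigma1 * sigma2)), m', t.
    split=> //; first exact: center_sign1.
      by rewrite !inE eqxx !orbT.
    by rewrite mul1g -Delta_sigma2 -!mulgA.
- exists (Delta * Delta), 1, (sigma1^-1 * m), t.
  split=> //; first exact: center_sign_Delta2.
  + by rewrite inE eqxx.
  + exact: coneMl.
  + by rewrite mulg1 !(mulgA (Delta * Delta)) -Delta_sigma12 -!mulgA.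
- exists (Delta * Delta), 1, (sigma2 * m), t.
  split=> //; first exact: center_sign_Delta2.
  + by rewrite inE eqxx.
  + exact: coneMr.
  + by rewrite mulg1 -Delta_sigma2 -!mulgA.
Qed.

Lemma normal_formP g : normal_form g.
Proof.
have rotV h : (sigma1 * sigma2)^-1 * h =
    (Delta * Delta)^-1 * (sigma1 * sigma2 * (sigma1 * sigma2 * h)).
  apply: (mulgI (Delta * Delta)); rewrite [RHS]mulVKg {1}Delta_sq.
  by rewrite !mulgA -(mulgA _ sigma1) mulgK.
have DeltaV h : Delta^-1 * h = (Delta * Delta)^-1 * (Delta * h).
  by rewrite (invgM Delta) -(mulgA Delta^-1) mulKg.
have nfDV h : normal_form h -> normal_form (Delta^-1 * h).
  move=> ?; rewrite DeltaV; apply/normal_form_center/normal_form_Delta => //.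
  exact: center_sign_Delta2V.
have nfRV h : normal_form h -> normal_form ((sigma1 * sigma2)^-1 * h).
  move=> ?; rewrite rotV; apply/normal_form_center.
    exact: center_sign_Delta2V.
  exact/normal_form_rot/normal_form_rot.
have D1 : sigma1 = (sigma1 * sigma2)^-1 * Delta by rewrite mulKg.
have D2 : sigma2 = Delta * (sigma1 * sigma2)^-1.
  by rewrite /Delta sigma_braid -(mulgA sigma2) mulgK.
elim/B3_ind: g => [|g gP|g gP|g gP|g gP].
- exists 1, 1, 1, 1; rewrite !mul1g !inE eqxx.
  by split=> //; [exact: center_sign1 | exact: cone1].
- by rewrite D1 -mulgA; apply/nfRV/normal_form_Delta.
- by rewrite D1 invgM invgK -mulgA; apply/nfDV/normal_form_rot.
- by rewrite D2 -mulgA; apply/normal_form_Delta/nfRV.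
- by rewrite D2 invgM invgK -mulgA; apply/normal_form_rot/nfDV.
Qed.

(** The stabilizer of the line of e_1 is generated by sigma_1 and the centre.  For
    a normal form z x^i m t, cone positivity of [m] leaves two cases: i = 0, t = 1
    and [m] a power of sigma_1; or i = 2, t = Delta and [m] a power of sigma_2. *)
Lemma sigma1_centralizer g : (rho g (1, 0)%Z).2 = 0%Z -> commute g sigma1.
Proof.
have [z [r [m [t [[zC [s s2 zE]] rP mC tP ->]]]]] := normal_formP g.
suff K : (rho (r * m * t) (1, 0)%Z).2 = 0%Z -> commute (r * m * t) sigma1.
  rewrite -!(mulgA z) rhoM zE => E.
  apply/commute_sym/commuteM/commute_sym/K; first exact/commute_sym.
  by case/Z.mul_eq_0: E => // s0; rewrite s0 in s2.
have [p [q [E1 ?]]] := cone_monoid_act mC (p := 1) (q := 0) ltac:(lia) ltac:(lia).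
have [p' [q' [E2 ?]]] := cone_monoid_act mC (p := 0) (q := 1) ltac:(lia) ltac:(lia).
move: rP tP; rewrite !inE => /or3P[] /eqP -> /orP[] /eqP ->.
- by rewrite mul1g mulg1; apply: cone_monoid_fix_sigma1.
- by rewrite mul1g rhoM rho_Delta /= E2 /=; lia.
- by rewrite mulg1 !rhoM E1 rho_sigma1 rho_sigma2 /=; lia.
- rewrite (rhoM _ Delta) rho_Delta /= (rhoM _ m) E2 rhoM rho_sigma1 rho_sigma2 /=.
  by lia.
- by rewrite mulg1 !rhoM E1 !(rho_sigma1, rho_sigma2) /=; lia.
- rewrite (rhoM _ Delta) rho_Delta /= (rhoM _ m) E2 !rhoM.
  rewrite !(rho_sigma1, rho_sigma2) /= => q0.
  (* As x^2 = Delta sigma_2, the braid is Delta sigma_2 m Delta with m a power of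
     sigma_2, and conjugation by Delta exchanges sigma_1 and sigma_2. *)
  have C : m * sigma2 = sigma2 * m.
    by apply: cone_monoid_fix_sigma2; rewrite // E2 /=; lia.
  rewrite -Delta_sigma2 /commute; move: Delta Delta_conj1 Delta_conj2 => D D1 D2.
  by rewrite -!mulgA D1 (mulgA m) C !mulgA D2.
Qed.

(** * Half-twists and their vectors *)

Lemma det_e1 w : det (1, 0)%Z w = w.2.
Proof. by case: w => p q; rewrite /det; cbv [fst snd]; ring. Qed.

(** [v] is only determined by [g] up to sign, hence a relation. *)
Definition twist_vec (g : B3) (v : Z * Z) : Prop :=
  exists2 h, g = h * sigma1 * h^-1 & v = rho h (1, 0)%Z.

Lemma half_twist_vec g : positive_half_twist g -> exists v, twist_vec g v.
Proof.
move=> [h ->]; exists (rho h^-1 (1, 0)%Z), h^-1 => //.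
by rewrite conjgE invgK -mulgA.
Qed.

Lemma twist_vec_conj k g v :
  twist_vec g v -> twist_vec (k * g * k^-1) (rho k v).
Proof.
by move=> [h -> ->]; exists (k * h); rewrite ?rhoM // invgM -!mulgA.
Qed.

Lemma twist_vec_sigma1 : twist_vec sigma1 (1, 0)%Z.
Proof. by exists 1; rewrite ?rho1 // mul1g invg1 mulg1. Qed.

Lemma twist_vec_sigma2 : twist_vec sigma2 (0, -1)%Z.
Proof.
exists (sigma1 * sigma2); last by rewrite rhoM rho_sigma2 rho_sigma1.
by rewrite sigma_braid invgM !mulgA !mulgK.
Qed.

Lemma twist_vec_act g v w :
  twist_vec g v -> rho g w = shear v (det v w) w.
Proof.
move=> [h -> ->]; have {1}-> : w = rho h (rho h^-1 w) by rewrite -rhoM mulgV rho1.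
rewrite -rhoM mulgVK rhoM.
have -> u : rho sigma1 u = shear (1, 0)%Z (det (1, 0)%Z u) u.
  by rewrite rho_sigma1 /shear /det; cbn [fst snd]; congr pair; ring.
by rewrite rho_shear -(rho_det h) -!rhoM mulgV rho1.
Qed.

Lemma twist_vec_actV g v w :
  twist_vec g v -> rho g^-1 w = shear v (- det v w) w.
Proof.
move=> gv; apply: (can_inj (rhoK g)); rewrite -rhoM mulgV rho1.
rewrite (twist_vec_act _ gv); case: v w {gv} => [a b] [p q].
by rewrite /shear /det; cbn [fst snd]; congr pair; ring.
Qed.

(** Primitive vectors with zero determinant are equal up to sign, so the braid
    relating the two half-twists preserves a line. *)
Lemma twist_vec_inj g g' v v' :
  twist_vec g v -> twist_vec g' v' -> det v v' = 0%Z -> g = g'.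
Proof.
move=> [h -> ->] [k -> ->]; rewrite -(rho_det h^-1) rhoK -rhoM => E.
have C : commute (h^-1 * k) sigma1 by apply: sigma1_centralizer; rewrite -det_e1.
rewrite -[k](mulVKg h); move: (h^-1 * k) C => c C.
by rewrite invgM !mulgA -(mulgA h c) C !mulgA mulgK.
Qed.

(** The witness is the second column of the unimodular matrix of [h]. *)
Lemma twist_vec_primitive g v :
  twist_vec g v -> exists a b, (v.1 * b - v.2 * a = 1)%Z.
Proof.
move=> [h _ ->]; exists (rho h (0, 1)%Z).1, (rho h (0, 1)%Z).2.
exact: (rho_det h (1, 0)%Z (0, 1)%Z).
Qed.

(** * Hurwitz moves *)

Section Hurwitz.
Variable G : groupType.
Implicit Types (a b d g h : G) (s t : seq G).

Lemma hurwitz_equivalent_factorization g s t :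
    (forall h, commute g h) -> hurwitz_equivalent s t ->
  factorization g s -> factorization g t.
Proof.
move=> gZ; elim=> {s t} [_ _ [s x y t|s x y t|h s]|//|s t u _ IH1 _ IH2].
- by rewrite /factorization !big_cat !big_cons /= !mulgA mulgVK.
- by rewrite /factorization !big_cat !big_cons /= !mulgA mulgK.
- rewrite /factorization big_map => sg.
  suff -> : \prod_(x <- s) (h * x * h^-1) = h * (\prod_(x <- s) x) * h^-1.
    by rewrite sg -gZ mulgK.
  elim: s {sg} => [|x s IH]; first by rewrite !big_nil mulg1 mulgV.
  by rewrite !big_cons IH !mulgA mulgVK.
- by move/IH1/IH2.
Qed.

(** Each left move carries [g] past its left neighbour at the cost of
    conjugating it, and leaves the neighbour itself unchanged. *)
Lemma hurwitz_front s g t :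
  exists k, hurwitz_equivalent (s ++ g :: t) (k * g * k^-1 :: s ++ t).
Proof.
elim/last_ind: s g t => [|s h IH] g t.
  by exists 1; rewrite mul1g invg1 mulg1; apply: rt_refl.
have [k E] := IH (h * g * h^-1) (h :: t); exists (k * h).
rewrite invgM !mulgA !cat_rcons.
apply: rt_trans (rt_step _ _ _ _ (hurwitz_move_l s h g t)) _.
by rewrite -!mulgA in E *.
Qed.

Lemma hurwitz_left1 a g h d :
  hurwitz_equivalent [:: a; g; h; d] [:: a; g * h * g^-1; g; d].
Proof. exact: rt_step (hurwitz_move_l [:: a] g h [:: d]). Qed.

Lemma hurwitz_right1 a g h d :
  hurwitz_equivalent [:: a; g; h; d] [:: a; h; h^-1 * g * h; d].
Proof. exact: rt_step (hurwitz_move_r [:: a] g h [:: d]). Qed.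

Lemma hurwitz_left2 a b g h :
  hurwitz_equivalent [:: a; b; g; h] [:: a; b; g * h * g^-1; g].
Proof. exact: rt_step (hurwitz_move_l [:: a; b] g h [::]). Qed.

Lemma hurwitz_right2 a b g h :
  hurwitz_equivalent [:: a; b; g; h] [:: a; b; h; h^-1 * g * h].
Proof. exact: rt_step (hurwitz_move_r [:: a; b] g h [::]). Qed.

End Hurwitz.

(** * The relations between heights *)

Definition standard_factorization : seq B3 :=
  [:: sigma1 ^+ 3; sigma1^-1 * sigma2 * sigma1; sigma1; sigma2].

Lemma standard_factorizationP : factorization (Delta ^+ 2) standard_factorization.
Proof.
rewrite /factorization /standard_factorization !big_cons big_nil mulg1.
transitivity (sigma1 * Delta * sigma1 * sigma2).
  by rewrite !expgS expg0 mulg1 /Delta !mulgA mulgK.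
transitivity (Delta * (sigma2 * sigma1 * sigma2)); last by rewrite -sigma_braid.
by rewrite Delta_conj2 !mulgA.
Qed.

Lemma Delta2_central g : commute (Delta ^+ 2) g.
Proof. exact: Delta_sq_central. Qed.

(** Delta^2 acts by -1 and sigma_1^3 fixes e_1. *)
Lemma factorization_act (b c d : B3) :
    factorization (Delta ^+ 2) [:: sigma1 ^+ 3; b; c; d] ->
  rho b (rho c (rho d (1, 0)%Z)) = (-1, 0)%Z.
Proof.
rewrite /factorization !big_cons big_nil mulg1 => E.
apply: (can_inj (rhoK (sigma1 ^+ 3))); rewrite -(rhoM c) -(rhoM b) -rhoM E.
by rewrite (rhoM Delta Delta) !rho_Delta !rhoM !rho_sigma1.
Qed.

(** Compare second coordinates in c d e_1 = b^-1 (- e_1), respectively in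
    d e_1 = c^-1 b^-1 (- e_1). *)
Lemma height_relations (b c d : B3) (u v w : Z * Z) :
    twist_vec b u -> twist_vec c v -> twist_vec d w ->
    rho b (rho c (rho d (1, 0)%Z)) = (-1, 0)%Z ->
  (u.2 * u.2 = v.2 * v.2 + w.2 * w.2 + det v w * v.2 * w.2 /\
   w.2 * w.2 = u.2 * u.2 + v.2 * v.2 + det u v * u.2 * v.2)%Z.
Proof.
move=> bu cv dw E.
have E1 : rho c (rho d (1, 0)%Z) = rho b^-1 (-1, 0)%Z by rewrite -E rhoK.
have E2 : rho d (1, 0)%Z = rho c^-1 (rho b^-1 (-1, 0)%Z) by rewrite -E1 rhoK.
move: E1 E2; rewrite (twist_vec_act _ dw) (twist_vec_act _ cv).
rewrite (twist_vec_actV _ bu) (twist_vec_actV _ cv) /shear /det.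
case: u v w {bu cv dw E} => [a b'] [p q] [r s] /(f_equal snd) E1 /(f_equal snd) E2.
by move: E1 E2; cbv [fst snd] => E1 E2; split; lia.
Qed.

(** * Factorizations containing sigma_1^3 and sigma_1 *)

(** The powers of sigma_1. *)
Lemma sigma1_shift (k : Z) :
  exists2 s : B3, commute s sigma1 & forall v, rho s v = (v.1 + k * v.2, v.2)%Z.
Proof.
elim/Z.peano_ind: k => [|k [s C E]|k [s C E]].
- exists 1; first exact/commute_sym/commute1.
  by case=> p q; rewrite rho1 /= Z.add_0_r.
- exists (s * sigma1); first by rewrite /commute C -!mulgA C.
  by case=> p q; rewrite rhoM rho_sigma1 E; cbv [fst snd]; congr pair; ring.
- exists (s * sigma1^-1).
    by apply/commute_sym/commuteM; [exact/commute_sym | exact/commuteV].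
  by case=> p q; rewrite rhoM rho_sigma1V E; cbv [fst snd Z.pred]; congr pair; ring.
Qed.

(** With (r, s) and (p, q) the vectors of [d] and [c], the second height relation
    reads s^2 = q^2, and the first coordinate of d e_1 = c^-1 (- e_1) says that
    s r - q p = 2.  So q divides 2; and if q = 2 or -2, then r - p or r + p is 1 or
    -1, so that one of r and p is even, like s and q, against primitivity. *)
Lemma height_one_of_sigma1 (c d : B3) (v w : Z * Z) :
    twist_vec c v -> twist_vec d w ->
    factorization (Delta ^+ 2) [:: sigma1 ^+ 3; sigma1; c; d] ->
  (v.2 = 1 \/ v.2 = -1)%Z.
Proof.
move=> cv dw /factorization_act E.
have [_ H] := height_relations twist_vec_sigma1 cv dw E.
have {E} E1 : rho c (rho d (1, 0)%Z) = (-1, 0)%Z.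
  by apply: (can_inj (rhoK sigma1)); rewrite E rho_sigma1.
have {E1} : rho d (1, 0)%Z = rho c^-1 (-1, 0)%Z by rewrite -E1 rhoK.
have [a [b Pv]] := twist_vec_primitive cv.
have [a' [b' Pw]] := twist_vec_primitive dw.
rewrite (twist_vec_act _ dw) (twist_vec_actV _ cv) /shear /det.
case: v w {cv dw} H Pv Pw => [p q] [r s] H Pv Pw /(f_equal fst) E.
move: E H Pv Pw; cbv [fst snd] => E H Pv Pw.
have qdvd : exists m, [/\ q * m = 2, m = r - p \/ m = - r - p & s = q \/ s = - q]%Z.
  have [sq | sq] : (s = q \/ s = - q)%Z by nia.
    by exists (r - p)%Z; split; [nia | left | left].
  by exists (- r - p)%Z; split; [nia | right | right].
have {qdvd} [m [qm mE sE]] := qdvd.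
have q_le2 : (Z.abs q <= 2)%Z.
  by apply: Z.divide_pos_le => //; apply/Z.divide_abs_l; exists m; lia.
have q_neq0 : (q <> 0)%Z by move=> q0; rewrite q0 in qm.
have [?|[?|q2]] : (q = 1 \/ q = -1 \/ (q = 2 \/ q = -2))%Z by lia.
- by left.
- by right.
have odd_fst x y k l : (x * k - y * l = 1)%Z -> (y = 2 \/ y = -2)%Z -> Z.Odd x.
  move=> Exy y2; case: (Z.Even_or_Odd x) => // -[x' Ex]; exfalso.
  by case: y2 Exy => ->; rewrite Ex; lia.
have [p' Ep] := odd_fst _ _ _ _ Pv q2.
have [r' Er] : Z.Odd r by apply: odd_fst Pw _; lia.
by exfalso; case: q2 qm => ->; lia.
Qed.

(** Conjugation by a suitable power of sigma_1 gives [c] the vector (2, -1) or its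
    opposite, that of the half-twist [c0] which one left move past sigma_1 turns
    into sigma_1^-1 sigma_2 sigma_1. *)
Lemma hurwitz_standard_of_sigma1 (c d : B3) (v w : Z * Z) :
    twist_vec c v -> twist_vec d w ->
    factorization (Delta ^+ 2) [:: sigma1 ^+ 3; sigma1; c; d] ->
  hurwitz_equivalent [:: sigma1 ^+ 3; sigma1; c; d] standard_factorization.
Proof.
move=> cv dw F.
have v2 := height_one_of_sigma1 cv dw F.
(* As v_2 is 1 or -1, this shift sends v to (-2 v_2, v_2). *)
have [s C sE] := sigma1_shift (-2 - v.1 * v.2).
have CX n : s * sigma1 ^+ n * s^-1 = sigma1 ^+ n.
  by rewrite (commuteX n C) mulgK.
have step1 := rt_step _ _ _ _ (hurwitz_global_conj s [:: sigma1 ^+ 3; sigma1; c; d]).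
rewrite /= CX (CX 1%nat) in step1.
pose c0 := sigma1^-1 * (sigma1^-1 * sigma2 * sigma1) * sigma1.
have c0v : twist_vec c0 (2, -1)%Z.
  have := twist_vec_conj (sigma1^-1 * sigma1^-1) twist_vec_sigma2.
  by rewrite invgM !invgK rhoM !rho_sigma1V /= /c0 !mulgA.
have ec : s * c * s^-1 = c0.
  apply: (twist_vec_inj (twist_vec_conj s cv) c0v).
  by rewrite sE /det; case: (v) v2 => p q; cbv [fst snd] => -[] ->; lia.
rewrite ec in step1.
have step2 := rt_trans _ _ _ _ _ step1 (hurwitz_left1 _ _ _ _).
have c1E : sigma1 * c0 * sigma1^-1 = sigma1^-1 * sigma2 * sigma1.
  by rewrite /c0 !mulgA mulgK mulgV mul1g.
rewrite c1E in step2.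
have := hurwitz_equivalent_factorization Delta2_central step2 F.
rewrite /factorization -standard_factorizationP /standard_factorization !big_cons.
by move=> /mulgI/mulgI/mulgI/mulIg dE; rewrite dE in step2.
Qed.

(** * The descent *)

Lemma twist_vec_horizontal g v : twist_vec g v -> v.2 = 0%Z -> g = sigma1.
Proof.
move=> gv v2; apply: (twist_vec_inj gv twist_vec_sigma1).
by rewrite /det v2; cbv [fst snd]; lia.
Qed.

(** Two numbers in the interval (0, t^2] differ by less than t^2. *)
Lemma abs_lt_of_mul_eq_sqrB (x y z t : Z) :
  (t * x = y * y - z * z -> Z.abs y <= Z.abs t -> Z.abs z <= Z.abs t ->
   y <> 0 -> z <> 0 -> Z.abs x < Z.abs t)%Z.
Proof.
move=> E yt zt y0 z0.
have : (Z.abs t * Z.abs x < Z.abs t * Z.abs t)%Z.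
  by rewrite -Z.abs_mul E; nia.
by nia.
Qed.

Lemma twist_vec_conjE g h v w :
  twist_vec g v -> twist_vec h w -> twist_vec (g * h * g^-1) (shear v (det v w) w).
Proof. by move=> gv hw; rewrite -(twist_vec_act _ gv); apply: twist_vec_conj. Qed.

Lemma twist_vec_conjVE g h v w :
  twist_vec g v -> twist_vec h w ->
  twist_vec (h^-1 * g * h) (shear w (- det w v) v).
Proof.
move=> gv hw; rewrite -(twist_vec_actV _ hw) -{2}[h]invgK.
exact: twist_vec_conj.
Qed.

(** By induction on the total height: if a height vanishes, the corresponding
    half-twist is sigma_1 and is moved to the second place; otherwise the move at
    a largest height lowers it strictly and keeps the other two. *)
Lemma hurwitz_descent n (b c d : B3) (u v w : Z * Z) :
    twist_vec b u -> twist_vec c v -> twist_vec d w ->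
    (Z.abs u.2 + Z.abs v.2 + Z.abs w.2 < Z.of_nat n)%Z ->
    factorization (Delta ^+ 2) [:: sigma1 ^+ 3; b; c; d] ->
  hurwitz_equivalent [:: sigma1 ^+ 3; b; c; d] standard_factorization.
Proof.
elim: n b c d u v w => [|n IH] b c d u v w bu cv dw ltn F; first by lia.
have move_to t : hurwitz_equivalent [:: sigma1 ^+ 3; b; c; d] t ->
    (factorization (Delta ^+ 2) t -> hurwitz_equivalent t standard_factorization) ->
    hurwitz_equivalent [:: sigma1 ^+ 3; b; c; d] standard_factorization.
  move=> E K; apply: rt_trans (E) (K _).
  exact: hurwitz_equivalent_factorization Delta2_central E F.
case: (Z.eq_dec u.2 0) => [u0|u0].
  rewrite (twist_vec_horizontal bu u0) in F *.
  exact: hurwitz_standard_of_sigma1 cv dw F.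
case: (Z.eq_dec v.2 0) => [v0|v0].
  apply: (move_to _ (hurwitz_right1 _ _ _ _)) => {}F.
  have bc := twist_vec_conjVE bu cv.
  rewrite (twist_vec_horizontal cv v0) in F bc *.
  exact: hurwitz_standard_of_sigma1 bc dw F.
case: (Z.eq_dec w.2 0) => [w0|w0].
  apply: (move_to _ (rt_trans _ _ _ _ _ (hurwitz_right2 _ _ _ _)
                                        (hurwitz_right1 _ _ _ _))) => {}F.
  have bd := twist_vec_conjVE bu dw.
  have cd := twist_vec_conjVE cv dw.
  rewrite (twist_vec_horizontal dw w0) in F bd cd *.
  exact: hurwitz_standard_of_sigma1 bd cd F.
have [Eu Ew] := height_relations bu cv dw (factorization_act F).
have [[? ?]|[[? ?]|[? ?]]] :
    ((Z.abs v.2 <= Z.abs u.2 /\ Z.abs w.2 <= Z.abs u.2) \/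
     ((Z.abs u.2 <= Z.abs v.2 /\ Z.abs w.2 <= Z.abs v.2) \/
      (Z.abs u.2 <= Z.abs w.2 /\ Z.abs v.2 <= Z.abs w.2)))%Z by lia.
- have lt : (Z.abs (shear v (- det v u) u).2 < Z.abs u.2)%Z.
    apply: (@abs_lt_of_mul_eq_sqrB _ w.2 v.2) => //.
    by rewrite Ew /shear /det; cbv [snd]; ring.
  apply: (move_to _ (hurwitz_right1 _ _ _ _)).
  by apply: IH cv (twist_vec_conjVE bu cv) dw _; lia.
- have lt : (Z.abs (shear w (- det w v) v).2 < Z.abs v.2)%Z.
    apply: (@abs_lt_of_mul_eq_sqrB _ u.2 w.2) => //.
    by rewrite Eu /shear /det; cbv [snd]; ring.
  apply: (move_to _ (hurwitz_right2 _ _ _ _)).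
  by apply: IH bu dw (twist_vec_conjVE cv dw) _; lia.
- have lt : (Z.abs (shear v (det v w) w).2 < Z.abs w.2)%Z.
    apply: (@abs_lt_of_mul_eq_sqrB _ u.2 v.2) => //.
    by rewrite Eu /shear /det; cbv [snd]; ring.
  apply: (move_to _ (hurwitz_left2 _ _ _ _)).
  by apply: IH bu (twist_vec_conjE cv dw) cv _; lia.
Qed.

(** * Bringing the cube to the front *)

Lemma hurwitz_standard (b c d : B3) :
    positive_half_twist b -> positive_half_twist c -> positive_half_twist d ->
    factorization (Delta ^+ 2) [:: sigma1 ^+ 3; b; c; d] ->
  hurwitz_equivalent [:: sigma1 ^+ 3; b; c; d] standard_factorization.
Proof.
move=> /half_twist_vec[u bu] /half_twist_vec[v cv] /half_twist_vec[w dw].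
apply: (hurwitz_descent (n := Z.to_nat (Z.abs u.2 + Z.abs v.2 + Z.abs w.2 + 1))
  bu cv dw).
by lia.
Qed.

Lemma positive_half_twist_conj g h :
  positive_half_twist g -> positive_half_twist (h * g * h^-1).
Proof.
by move=> [k ->]; exists (k * h^-1); rewrite conjgM [RHS]conjgE invgK -mulgA.
Qed.

Lemma hurwitz_cube_to_standard (s t : seq B3) (g b c d : B3) :
    cube_of_half_twist g -> s ++ t = [:: b; c; d] ->
    positive_half_twist b -> positive_half_twist c -> positive_half_twist d ->
    factorization (Delta ^+ 2) (s ++ g :: t) ->
  hurwitz_equivalent (s ++ g :: t) standard_factorization.
Proof.
move=> [x [h xE] gE] st hb hc hd F.
have [k E] := hurwitz_front s g t; rewrite st in E.
have E' := rt_trans _ _ _ _ _ E (rt_step _ _ _ _ (hurwitz_global_conj (h * k^-1) _)).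
have e : h * k^-1 * (k * g * k^-1) * (h * k^-1)^-1 = sigma1 ^+ 3.
  rewrite gE xE -conjXg conjgE invgM invgK; move: (sigma1 ^+ 3) => y.
  by rewrite !mulgA !mulgVK mulgV mul1g mulgK.
rewrite /= e in E'.
apply: rt_trans (E') _; apply: hurwitz_standard; try exact: positive_half_twist_conj.
exact: hurwitz_equivalent_factorization Delta2_central E' F.
Qed.

Theorem theorem4p46 (F : 4.-tuple B3) :
  factorization (Delta ^+ 2) F ->
  (exists i : 'I_4,
      cube_of_half_twist (tnth F i) /\
      forall j : 'I_4, j != i -> positive_half_twist (tnth F j)) ->
  let F0 := [:: sigma1 ^+ 3; sigma1^-1 * sigma2 * sigma1; sigma1; sigma2] in
  factorization (Delta ^+ 2) F0 /\ hurwitz_equivalent F F0.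
Proof.
move=> FP [i [cube half]] F0; split; first exact: standard_factorizationP.
case: F FP cube half => -[|a [|b [|c [|d []]]]] //= F4 FP cube half.
have tw (j : nat) (lt : (j < 4)%nat) :
    j != i -> positive_half_twist (nth a [:: a; b; c; d] j).
  by move=> ne; have := half (Ordinal lt) ne; rewrite (tnth_nth a).
move: cube; rewrite (tnth_nth a) /=; case: i tw {half} => -[|[|[|[|//]]]] /= lt tw cube.
- exact: (hurwitz_cube_to_standard (s := [::]) cube erefl
           (tw 1%nat _ _) (tw 2%nat _ _) (tw 3%nat _ _)).
- exact: (hurwitz_cube_to_standard (s := [:: a]) cube erefl
           (tw 0%nat _ _) (tw 2%nat _ _) (tw 3%nat _ _)).
- exact: (hurwitz_cube_to_standard (s := [:: a; b]) cube erefl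
           (tw 0%nat _ _) (tw 1%nat _ _) (tw 3%nat _ _)).
- exact: (hurwitz_cube_to_standard (s := [:: a; b; c]) cube erefl
           (tw 0%nat _ _) (tw 1%nat _ _) (tw 2%nat _ _)).
Qed.
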